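(* Let $\mathfrak{B}$ be a bornology on a metric space $X$ with a closed base. Let $\mathcal{I},\mathcal{J}$ be ideals on $\omega$ and let $\mathcal{J}$ have a pseudounion. The following statements are equivalent. (1) $X$ satisfies $\mathrm{S}_1(\mathcal{I}\text{-}\Gamma_{\mathfrak{B}^s},\mathcal{J}\text{-}\Gamma_{\mathfrak{B}^s})$. (2) $X$ satisfies $\mathrm{S}_1(\mathcal{I}\text{-}\Gamma_{\mathfrak{B}^s},\Gamma_{\mathfrak{B}^s})$.
   Context: $(X,d)$ is an infinite metric space; $\omega$ is the set of natural numbers. A bornology $\mathfrak{B}$ on $X$ is a family of subsets of $X$ that is closed under subsets and finite unions and covers $X$. A base of $\mathfrak{B}$ is a subfamily $\mathfrak{B}_0\subseteq\mathfrak{B}$ such that every $B\in\mathfrak{B}$ is contained in some $B_0\in\mathfrak{B}_0$; it is a closed base if its members are closed. For $B\in\mathfrak{B}$, $\delta>0$: $B^\delta=\bigcup_{x\in B}\{y\in X:d(x,y)<\delta\}$. An ideal on $\omega$ is a family $\mathcal{I}\subseteq\mathcal{P}(\omega)$ closed under subsets and finite unions, containing all finite sets, with $\omega\notin\mathcal{I}$. A set $A\subseteq\omega$ is a pseudounion of an ideal $\mathcal{J}$ if $\omega\setminus A$ is infinite and $I\setminus A$ is finite for every $I\in\mathcal{J}$. Covers of $X$ never contain $X$ as an element. An open cover $\{U_n:n\in\omega\}$ (with its enumeration) is a $\gamma_{\mathfrak{B}^s}$-cover if it is infinite and for each $B\in\mathfrak{B}$ there are $n_0\in\omega$ and positive reals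 $\delta_n$ ($n\geq n_0$) with $B^{\delta_n}\subseteq U_n$ for all $n\geq n_0$; $\Gamma_{\mathfrak{B}^s}$ is the class of these. A countable open cover $\{U_n:n\in\omega\}$ (with its enumeration) is an $\mathcal{I}$-$\gamma_{\mathfrak{B}^s}$-cover if for each $B\in\mathfrak{B}$ there is a sequence $\{\delta_n\}$ of positive reals with $\{n\in\omega:B^{\delta_n}\nsubseteq U_n\}\in\mathcal{I}$; $\mathcal{I}\text{-}\Gamma_{\mathfrak{B}^s}$ is the class of these. $\mathrm{S}_1(\mathcal{A},\mathcal{B})$: for every sequence $\{A_n:n\in\omega\}$ of elements of $\mathcal{A}$ there are $a_n\in A_n$ ($n\in\omega$) such that $\{a_n:n\in\omega\}\in\mathcal{B}$ (for enumerated covers, with the enumeration $n\mapsto a_n$). *)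

(* Defs.v *)
From HB Require Import structures.
From mathcomp Require Import all_boot all_order all_algebra.
From mathcomp Require Import all_classical all_reals all_analysis.

Set Implicit Arguments.
Unset Strict Implicit.
Unset Printing Implicit Defensive.

Local Open Scope classical_set_scope.
Local Open Scope ring_scope.

Definition subset_closed (T : Type) (F : set_system T) : Prop :=
  forall A B : set T, A `<=` B -> F B -> F A.

Record bornology (T : Type) (BB : set_system T) : Prop := Bornology {
  bornology_subset : subset_closed BB ;
  bornology_setU : setU_closed BB ;
  bornology_cover : \bigcup_(B in BB) B = [set: T] }.

Definition base_of (T : Type) (BB BB0 : set_system T) : Prop :=
  BB0 `<=` BB /\ forall B, BB B -> exists2 B0, BB0 B0 & B `<=` B0.

Definition has_closed_base (T : topologicalType) (BB : set_system T) : Prop :=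
  exists BB0 : set_system T,
    base_of BB BB0 /\ (forall B0, BB0 B0 -> closed B0).

Record omega_ideal (I : set_system nat) : Prop := OmegaIdeal {
  omega_ideal_subset : subset_closed I ;
  omega_ideal_setU : setU_closed I ;
  omega_ideal_finite : forall A, finite_set A -> I A ;
  omega_ideal_proper : ~ I [set: nat] }.

Definition pseudounion (J : set_system nat) (A : set nat) : Prop :=
  infinite_set (~` A) /\ forall I, J I -> finite_set (I `\` A).

Definition enlargement (R : realType) (X : metricType R) (B : set X) (delta : R)
  : set X := \bigcup_(x in B) [set y | mdist x y < delta].

(* Covers are enumerated families; the enumeration need not be injective. *)
Record open_cover (T : topologicalType) (U : nat -> set T) : Prop := OpenCover {
  open_cover_open : forall n, open (U n) ;
  open_cover_cover : cover [set: nat] U = [set: T] ;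
  open_cover_nontrivial : forall n, U n <> [set: T] }.

Definition Gamma_Bs (R : realType) (X : metricType R) (BB : set_system X)
  : set (nat -> set X) :=
  [set U | [/\ open_cover U, infinite_set (range U) &
    forall B, BB B -> exists (n0 : nat) (delta : nat -> R),
      forall n, (n0 <= n)%N ->
        0 < delta n /\ enlargement B (delta n) `<=` U n]].

Definition I_Gamma_Bs (R : realType) (X : metricType R) (I : set_system nat)
    (BB : set_system X) : set (nat -> set X) :=
  [set U | open_cover U /\
    forall B, BB B -> exists delta : nat -> R,
      (forall n, 0 < delta n) /\
      I [set n | ~ (enlargement B (delta n) `<=` U n)]].

Definition S1 (T : Type) (AA BB : set (nat -> set T)) : Prop :=
  forall A : nat -> nat -> set T, (forall n, AA (A n)) ->
    exists a : nat -> set T, (forall n, range (A n) (a n)) /\ BB a.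

(* Main.v *)
Require Import Defs.
From HB Require Import structures.
From mathcomp Require Import all_boot all_order all_algebra.
From mathcomp Require Import all_classical all_reals all_analysis.

(** For a bornology, [Gamma_Bs BB] is exactly [I_Gamma_Bs finite_set BB]
    ([I_Gamma_Bs_finite_set]). The one nontrivial point is that such a family
    has infinite range: a set [V] occurring infinitely often would contain
    every member of the bornology, hence all of the space, whereas no set of a
    cover is the whole space.

    Since [J] contains all finite sets, (2) implies (1) is then monotonicity in
    the ideal. For (1) implies (2), let [A] be a pseudounion of [J] and let [f]
    be an injection of [nat] into its complement. Given covers [C k], apply (1)
    to a sequence whose term at the index [f k] is [C k], and keep only the sets
    selected at the indices [f k]. The exceptional set of a member of the
    bornology lies in [J], so it meets the complement of [A] in a finite set,
    and its preimage under [f] is finite ([I_Gamma_Bs_reindex]). *)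

Set Implicit Arguments.
Unset Strict Implicit.
Unset Printing Implicit Defensive.

Local Open Scope classical_set_scope.

Local Open Scope ring_scope.

Lemma bornology_point (T : Type) (BB : set_system T) (x : T) :
  bornology BB -> exists2 B, BB B & B x.
Proof.
move=> bornBB; have : (\bigcup_(B in BB) B) x by rewrite (bornology_cover bornBB).
by case=> B; exists B.
Qed.

Lemma sub_enlargement (R : realType) (X : metricType R) (B : set X) (d : R) :
  0 < d -> B `<=` enlargement B d.
Proof. by move=> d0 x Bx; exists x => //=; rewrite mdistxx. Qed.

Lemma I_Gamma_Bs_mono (R : realType) (X : metricType R) (I J : set_system nat)
    (BB : set_system X) :
  I `<=` J -> I_Gamma_Bs I BB `<=` I_Gamma_Bs J BB.
Proof.
move=> IJ U [coverU convU]; split=> // B /convU[d [d0 badI]].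
by exists d; split=> //; exact: IJ.
Qed.

Section bornological_covers.
Context (R : realType) (X : metricType R) (BB : set_system X).
Context (bornBB : bornology BB).

(** The convergence condition forces the family to cover: a point [x] lies in
    some member [B] of the bornology, and [B] is contained in [U n] for every
    [n] outside a finite set, hence for at least one [n]. *)
Lemma I_Gamma_Bs_finite_set_intro (U : nat -> set X) :
    (forall n, open (U n)) -> (forall n, U n <> [set: X]) ->
    (forall B, BB B -> exists delta : nat -> R, (forall n, 0 < delta n) /\
      finite_set [set n | ~ (enlargement B (delta n) `<=` U n)]) ->
  I_Gamma_Bs finite_set BB U.
Proof.
move=> openU neqU convU; split=> //; split=> //.
apply/seteqP; split=> // x _.
have [B BBB Bx] := bornology_point x bornBB.
have [d [d0 fin_bad]] := convU _ BBB.
have : ~ [set: nat] `<=` [set n | ~ (enlargement B (d n) `<=` U n)].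
  by move=> sub; apply: infinite_nat; exact: sub_finite_set sub fin_bad.
move=> /existsNP[n /not_implyP[_ /contrapT BU]].
by exists n => //; exact/BU/sub_enlargement.
Qed.

Lemma I_Gamma_Bs_finite_range (U : nat -> set X) :
  I_Gamma_Bs finite_set BB U -> infinite_set (range U).
Proof.
move=> [[_ _ neqU] convU] fin_range; apply: infinite_nat.
suff fibers : forall V, range U V -> finite_set (U @^-1` [set V]).
  apply: sub_finite_set (bigcup_finite fin_range fibers) => n _.
  by exists (U n) => //; exists n.
(* A point outside [V] lies in a member of the bornology, and [V] can only
   occur at the exceptional indices of that member. *)
move=> _ [m _ <-].
have [x Ux] : exists x, ~ U m x.
  by apply/existsNP => allU; apply: (neqU m); apply/seteqP; split.
have [B BBB Bx] := bornology_point x bornBB.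
have [d [d0 fin_bad]] := convU _ BBB.
apply: sub_finite_set fin_bad => n /= Unm BU.
by apply: Ux; rewrite -Unm; exact/BU/sub_enlargement.
Qed.

Lemma I_Gamma_Bs_finite_set : I_Gamma_Bs finite_set BB = Gamma_Bs BB.
Proof.
apply/seteqP; split=> U.
- move=> GU; have inf_range := I_Gamma_Bs_finite_range GU.
  case: GU => coverU convU; split=> // B /convU[d [d0 fin_bad]].
  have /finite_seqP[s badE] := fin_bad.
  exists (\max_(i <- s) i).+1, d => n s_lt_n; split=> //; apply: contrapT => bad.
  have n_s : n \in s by have : [set` s] n by rewrite -badE.
  by move: s_lt_n; rewrite ltnNge leq_bigmax_seq.
- move=> [coverU _ convU]; split=> // B /convU[n0 [d convB]].
  (* Below [n0] nothing is known about [d], so any positive value is used. *)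
  exists (fun n => if (n0 <= n)%N then d n else 1); split.
    by move=> n; case: ifPn => // /convB[].
  apply: sub_finite_set (finite_II n0) => n /=.
  by rewrite ltnNge; case: ifPn => // /convB[].
Qed.

(** A subfamily of a cover need not cover; that [U \o f] does comes from
    convergence alone, through [I_Gamma_Bs_finite_set_intro]. Injectivity of [f]
    keeps preimages of finite sets finite. *)
Lemma I_Gamma_Bs_reindex (J : set_system nat) (A : set nat) (f : nat -> nat)
    (U : nat -> set X) :
    (forall S, J S -> finite_set (S `\` A)) ->
    injective f -> (forall k, ~ A (f k)) ->
  I_Gamma_Bs J BB U -> I_Gamma_Bs finite_set BB (U \o f).
Proof.
move=> finJ injf fA [[openU _ neqU] convU].
apply: I_Gamma_Bs_finite_set_intro => [n|n|B /convU[d [d0 /finJ fin_bad]]] /=.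
- exact: openU.
- exact: neqU.
exists (d \o f); split=> [n|]; first exact: d0.
have : finite_set (f @^-1` ([set n | ~ (enlargement B (d n) `<=` U n)] `\` A)).
  by apply: finite_preimage fin_bad => x y _ _; exact: injf.
by apply: sub_finite_set => k bad; split=> //; exact: fA.
Qed.

End bornological_covers.

Theorem theorem3p11 (R : realType) (X : metricType R)
    (X_infinite : infinite_set [set: X])
    (BB : set_system X) (bornBB : bornology BB) (baseBB : has_closed_base BB)
    (I J : set_system nat) (idealI : omega_ideal I) (idealJ : omega_ideal J)
    (pseudoJ : exists A : set nat, pseudounion J A) :
  S1 (I_Gamma_Bs I BB) (I_Gamma_Bs J BB) <->
  S1 (I_Gamma_Bs I BB) (Gamma_Bs BB).
Proof.
rewrite -(I_Gamma_Bs_finite_set bornBB); split=> S1X C GC; last first.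
  have [a [Ca Ga]] := S1X C GC; exists a; split=> //.
  exact: I_Gamma_Bs_mono (omega_ideal_finite idealJ) _ Ga.
have [A [/infiniteP/ppcard_leP[f] finJ]] := pseudoJ.
have fK : cancel f f^-1 by move=> k; apply: funK; rewrite in_setT.
have fA k : ~ A (f k) by exact: (@funS _ _ [set: nat] (~` A) f).
have [a [Ca Ga]] := S1X (C \o f^-1)%FUN (fun m => GC (f^-1%FUN m)).
exists (a \o f); split=> [k|]; first by have := Ca (f k); rewrite /= fK.
exact: I_Gamma_Bs_reindex finJ (can_inj fK) fA Ga.
Qed.
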